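(* There is an absolute constant $C>0$ such that the following holds. Let $n\ge 1$, let $\epsilon>0$, and let $v,w\in\mathbb{R}^n$ be such that all coordinates of $v$ are distinct and no real value occurs more than $(1-\epsilon)n$ times among the coordinates $w_1,\dots,w_n$ of $w$. Let $\pi$ be a uniformly random permutation in $S_n$. Then for any $x\in\mathbb{R}$, $$\mathbb{P}\left(w_\pi\cdot v=x\right)\le \frac{C}{\epsilon\, n^{3/2}}.$$
   Context: For a permutation $\pi\in S_n$, $w_\pi=(w_{\pi(1)},\dots,w_{\pi(n)})$, and $w_\pi\cdot v=\sum_{i=1}^n w_{\pi(i)}v_i$. *)

(* Defs.v *)
From HB Require Import structures.
From mathcomp Require Import all_boot all_order all_fingroup all_algebra.
From mathcomp Require Import reals exp.

Set Implicit Arguments.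
Unset Strict Implicit.
Unset Printing Implicit Defensive.

Import Order.TTheory GRing.Theory Num.Theory.
Local Open Scope ring_scope.

Definition uniform_prob (R : realType) (T : finType) (E : {set T}) : R :=
  #|E|%:R / #|T|%:R.

Definition dotv (R : realType) (n : nat) (u v : 'rV[R]_n) : R :=
  \sum_(i < n) u 0 i * v 0 i.

(* The permuted vector w_s has coordinates w_(s i): it is [col_perm s w]. *)
Lemma col_perm_coord (R : realType) (n : nat) (s : 'S_n) (w : 'rV[R]_n) (i : 'I_n) :
  col_perm s w 0 i = w 0 (s i).
Proof. by rewrite mxE. Qed.

Definition multiplicity (R : realType) (n : nat) (w : 'rV[R]_n) (y : R) : nat :=
  #|[set i : 'I_n | w 0 i == y]|.

(* Main.v *)
Require Import Defs.
From HB Require Import structures.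
From mathcomp Require Import all_boot all_order all_fingroup all_algebra.
From mathcomp Require Import reals exp.
From mathcomp Require Import zify ring lra.

Set Implicit Arguments.
Unset Strict Implicit.
Unset Printing Implicit Defensive.

Import Order.TTheory GRing.Theory Num.Theory.
Local Open Scope ring_scope.

(** Let [theta] be a median of the coordinates of [w].  As no value has
    multiplicity above [(1 - eps) n], one of the two open sides of [theta]
    contains [k] coordinates with [eps n / 2 <= k <= n / 2]; replacing [w] by
    [- w] if needed, it is the upper side.  Order the coordinates of [v]
    increasingly.  A permutation [s] is encoded by the [k]-set [X] of the indices
    that receive a weight above [theta], together with the orders in which the
    large and the small weights are laid out along [X] and its complement.  Once
    these two orders are fixed, moving [X] up in the dominance order strictly
    increases the linear form ([arranged_sum_lt]).  So each level set becomes an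
    antichain of [k]-sets for dominance, and it suffices to show that such an
    antichain [A] has at most [C / (n sqrt k)] times ['C(n, k)] elements
    ([dominance_antichain_card]).

    This bound gains a factor [n] and a factor [sqrt k] separately.  Cut [n] into
    a low block and a high block of [m = n / 8] elements each and a long middle
    block.  In a set [X] of [A], exchange an element of the middle block for a
    missing element of that block.  As the sets [x |: W] with [W] fixed form a
    chain, the result determines the original set up to at most
    [j = #|X :&: middle|] choices, whereas there are at least [j n / 4] exchanges:
    the family [B] of swapped sets is at least [n / 4] times as large as [A]
    ([antichain_exchange_count]).  On the other hand [B] is still thin.  Swaps in
    the middle perturb the counts which define dominance by one, whereas
    transferring two elements from the low to the high block raises them by two
    throughout the middle.  So, with the middle part of a swapped set fixed, no
    two members of [B] differ by such a double transfer
    ([middle_swaps_no_jump]).  A LYM inequality for the poset of transfers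
    ([lym_pairs]) then bounds the number of members by twice the largest level,
    which is a maximal hypergeometric weight, of relative size
    [O(1 / sqrt l)] where [l = k - j] ([hypergeom_sq]).  Averaging over [j] with
    the Vandermonde identity ([sum_bin_inv_le]) yields the factor [sqrt k].  Sets
    that avoid the middle block are treated by exchanging any of their elements
    for a middle one. *)

(** * Binomial estimates *)

(** The two bounds below on central coefficients are proved by induction through
    this recurrence; each step compares two consecutive polynomials in [s]. *)
Lemma central_bin_rec s :
  (s.+1 * 'C(s.+1.*2, s.+1) = 2 * s.*2.+1 * 'C(s.*2, s))%N.
Proof.
have e1 : (s.+1 * 'C(s.+1.*2, s.+1) = s.+1.*2 * 'C(s.*2.+1, s))%N.
  by rewrite -(mul_bin_diag s.+1.*2 s) doubleS.
have e2 : (s.+1 * 'C(s.*2.+1, s) = s.*2.+1 * 'C(s.*2, s))%N.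
  have := mul_bin_down s.*2.+1 s; rewrite /= => ->.
  by congr (_ * _)%N; lia.
have := e2; have := e1; rewrite -muln2; nia.
Qed.

Lemma central_bin_upper s : ('C(s.*2, s) ^ 2 * s.*2.+1 <= 16 ^ s)%N.
Proof.
elim: s => [|s IH]; first by rewrite bin0.
rewrite -(leq_pmul2l (_ : 0 < s.+1 ^ 2)%N); last by rewrite expn_gt0.
have -> : (s.+1 ^ 2 * ('C(s.+1.*2, s.+1) ^ 2 * s.+1.*2.+1) =
           (2 * s.*2.+1 * 'C(s.*2, s)) ^ 2 * s.+1.*2.+1)%N.
  by rewrite -central_bin_rec expnMn mulnA.
rewrite (expnS 16) mulnCA; apply: (@leq_trans
  (16 * (s.+1 ^ 2 * ('C(s.*2, s) ^ 2 * s.*2.+1)))); last by rewrite !leq_mul2l IH !orbT.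
rewrite -!muln2; set c := 'C(_, _).
have -> : ((2 * (s * 2).+1 * c) ^ 2 * (s.+1 * 2).+1 =
           c ^ 2 * (4 * (s * 2).+1 * ((s * 2).+1 * (s.+1 * 2).+1)))%N by ring.
have -> : (16 * (s.+1 ^ 2 * (c ^ 2 * (s * 2).+1)) =
           c ^ 2 * (16 * s.+1 ^ 2 * (s * 2).+1))%N by ring.
by rewrite leq_mul2l; apply/orP; right; nia.
Qed.

Lemma central_bin_lower s : (16 ^ s <= 'C(s.*2, s) ^ 2 * (4 * s).+1)%N.
Proof.
elim: s => [|s IH]; first by rewrite bin0.
rewrite -(leq_pmul2l (_ : 0 < s.+1 ^ 2)%N); last by rewrite expn_gt0.
have -> : (s.+1 ^ 2 * ('C(s.+1.*2, s.+1) ^ 2 * (4 * s.+1).+1) =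
           (2 * s.*2.+1 * 'C(s.*2, s)) ^ 2 * (4 * s.+1).+1)%N.
  by rewrite -central_bin_rec expnMn mulnA.
rewrite (expnS 16) mulnCA; apply: (@leq_trans
  (16 * (s.+1 ^ 2 * ('C(s.*2, s) ^ 2 * (4 * s).+1)))).
  by rewrite !leq_mul2l IH !orbT.
rewrite -!muln2; set c := 'C(_, _).
have -> : ((2 * (s * 2).+1 * c) ^ 2 * (4 * s.+1).+1 =
           c ^ 2 * (4 * (s * 2).+1 ^ 2 * (4 * s.+1).+1))%N by ring.
have -> : (16 * (s.+1 ^ 2 * (c ^ 2 * (4 * s).+1)) =
           c ^ 2 * (16 * s.+1 ^ 2 * (4 * s).+1))%N by ring.
by rewrite leq_mul2l; apply/orP; right; nia.
Qed.

Lemma leq_bin_step l a : (a.*2 < l)%N -> ('C(l, a) <= 'C(l, a.+1))%N.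
Proof.
move=> h; rewrite -(leq_pmul2l (ltn0Sn a)) mul_bin_left.
by rewrite leq_mul2r; apply/orP; right; lia.
Qed.

Lemma leq_bin_half l a : (a.*2 <= l)%N -> ('C(l, a) <= 'C(l, l./2))%N.
Proof.
move=> h; have {h} : (a <= l./2)%N by lia.
move: {2}(l./2 - a)%N (erefl (l./2 - a)%N) => r.
elim: r a => [|r IH] a e h; first by rewrite (_ : a = l./2) //; lia.
apply: (leq_trans (leq_bin_step (_ : a.*2 < l)%N)); first by lia.
by apply: IH; lia.
Qed.

Lemma leq_bin_mid l a : ('C(l, a) <= 'C(l, l./2))%N.
Proof.
case: (leqP a l) => [al|la]; last by rewrite bin_small.
case: (leqP a.*2 l) => [|h]; first exact: leq_bin_half.
by rewrite -bin_sub //; apply: leq_bin_half; lia.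
Qed.

Lemma bin_sq_upper l a : ('C(l, a) ^ 2 * l.+1 <= 4 ^ l)%N.
Proof.
apply: (@leq_trans ('C(l, l./2) ^ 2 * l.+1)).
  by rewrite leq_mul2r leq_sqr leq_bin_mid orbT.
have p4 s : (4 ^ s.*2 = 16 ^ s)%N by rewrite -mul2n expnM.
rewrite -(odd_double_half l); case: (odd l); rewrite ?add1n ?add0n; last first.
  by rewrite doubleK p4 central_bin_upper.
set s := l./2; rewrite (_ : s.*2.+1./2 = s)%N ?(expnS 4) ?p4; last by lia.
(* The two central coefficients of an odd row add up to the next central one. *)
have e : ('C(s.+1.*2, s.+1) = 2 * 'C(s.*2.+1, s))%N.
  rewrite doubleS binS -(bin_sub (_ : s.+1 <= s.*2.+1)%N); last by lia.
  by rewrite (_ : s.*2.+1 - s.+1 = s)%N; lia.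
have := central_bin_upper s.+1; rewrite e (expnS 16) -!muln2.
set c := 'C(_, _); set t := (16 ^ s)%N => h.
rewrite -(leq_pmul2l (isT : 0 < 4)%N); apply: leq_trans (_ : 16 * t <= _)%N; last by lia.
apply: leq_trans h; rewrite expnMn mulnA leq_mul2l; apply/orP; right; lia.
Qed.

(** Count in two ways the pairs made of an [m]-set and an [l]-set of a set of
    size [2 m] which meet in [a] points.  This rewrites the hypergeometric weight
    as a product of two symmetric binomial weights divided by a third one, and
    each of these is controlled by a central coefficient. *)
Lemma hypergeom_sq m l a : (a <= l)%N -> (a <= m)%N -> (l - a <= m)%N ->
  (('C(m, a) * 'C(m, l - a)) ^ 2 * (l.+1 * (m.*2 - l).+1)
     <= 'C(m.*2, l) ^ 2 * (4 * m).+1)%N.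
Proof.
move=> al am lam.
have id : ('C(m.*2, m) * ('C(m, a) * 'C(m, l - a)) =
           'C(m.*2, l) * ('C(l, a) * 'C(m.*2 - l, m - a)))%N.
  have lm : (l <= m.*2)%N by lia.
  have F : (0 < a`! * (m - a)`! * ((l - a)`! * (m - (l - a))`!))%N.
    by rewrite !muln_gt0 !fact_gt0.
  apply/eqP; rewrite -(eqn_pmul2r F); apply/eqP.
  have {F} := (bin_fact am, bin_fact lam, bin_fact al, bin_fact lm).
  have := bin_fact (_ : m <= m.*2)%N; move=> /(_ ltac:(lia)).
  have := bin_fact (_ : m - a <= m.*2 - l)%N; move=> /(_ ltac:(lia)).
  rewrite (_ : m.*2 - m = m)%N; last by lia.
  rewrite (_ : m.*2 - l - (m - a) = m - (l - a))%N; last by lia.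
  move: (m.*2 - l)`! (m.*2)`! (m - (l - a))`! (m - a)`! (l - a)`! l`! m`! a`!.
  move: 'C(m.*2, m) 'C(m, a) 'C(m, l - a) 'C(m.*2, l) 'C(l, a) 'C(m.*2 - l, m - a).
  move=> c1 c2 c3 c4 c5 c6 f1 f2 f3 f4 f5 f6 f7 f8 e1 e2 [[[e3 e4] e5] e6].
  transitivity f2; first by rewrite -e2 -{1}e3 -e4; ring.
  by rewrite -e6 -e5 -e1; ring.
have u1 := bin_sq_upper l a; have u2 := bin_sq_upper (m.*2 - l) (m - a).
have lo := central_bin_lower m.
have p4 : (4 ^ l * 4 ^ (m.*2 - l) = 16 ^ m)%N.
  by rewrite -expnD subnKC -?mul2n ?expnM // mul2n; lia.
set c := 'C(m.*2, m) in id lo.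
have c0 : (0 < c ^ 2)%N by rewrite expn_gt0 bin_gt0; lia.
rewrite -(leq_pmul2l c0) mulnA -expnMn id expnMn.
apply: (@leq_trans ('C(m.*2, l) ^ 2 * 16 ^ m)).
  rewrite -mulnA leq_mul2l; apply/orP; right; rewrite -p4 expnMn mulnACA.
  exact: leq_mul.
by rewrite mulnCA leq_mul2l lo orbT.
Qed.

(** * A LYM inequality for pairs of sets *)

(** The left-hand weights are averages of weights over the deletion of a point
    of [V]: [1 / 'C(v, a)] is [(v - a) / v] times [1 / 'C(v.-1, a)], and [v - a]
    is the number of points outside [a i]. *)
Lemma sum_inv_bin_delete (R : numFieldType) (T I : finType) (V : {set T})
    (F : {set I}) (a : I -> {set T}) (g : I -> R) :
  (forall i, i \in F -> a i \proper V) ->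
  \sum_(i in F) 'C(#|V|, #|a i|)%:R^-1 * g i =
  #|V|%:R^-1 * \sum_(x in V) \sum_(i in [set i in F | x \notin a i])
                 'C(#|V :\ x|, #|a i|)%:R^-1 * g i.
Proof.
move=> aV.
transitivity (#|V|%:R^-1 * \sum_(x in V) \sum_(i in F | x \notin a i)
    'C(#|V|.-1, #|a i|)%:R^-1 * g i); last first.
  congr (_ * _); apply: eq_bigr => x xV.
  apply: eq_big => [i|i _]; first by rewrite inE.
  by rewrite (cardsD1 x V) xV.
rewrite (exchange_big_dep [in F]) => [/=|x i _ /andP[]//].
rewrite mulr_sumr; apply: eq_bigr => i iF.
have /andP[sV /subsetPn[y yV ya]] := aV i iF.
rewrite sumr_const.
have -> : #|(fun x => [&& x \in V, i \in F & x \notin a i])| = (#|V| - #|a i|)%N.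
  rewrite -cardsDS //; apply: eq_card => x.
  by rewrite !inE /= unfold_in /= iF andbC.
have lt : (#|a i| < #|V|)%N by apply: proper_card; exact: aV.
have b0 : 'C(#|V|, #|a i|)%:R != 0 :> R by rewrite pnatr_eq0 -lt0n bin_gt0 ltnW.
have b1 : 'C(#|V|.-1, #|a i|)%:R != 0 :> R.
  by rewrite pnatr_eq0 -lt0n bin_gt0; lia.
have v0 : #|V|%:R != 0 :> R by rewrite pnatr_eq0; lia.
have := congr1 (fun k => k%:R : R) (mul_bin_down #|V| #|a i|).
rewrite /= !natrM -[(_ * g i) *+ _]mulr_natl => e.
apply: (mulfI b1); apply: (mulfI b0); apply: (mulfI v0).
move: e; set u := 'C(#|V|, _)%:R in b0 *; set u' := 'C(_, _)%:R in b1 *.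
set v := #|V|%:R in v0 *; move: (_ - _)%:R => z e.
by transitivity (v * u' * g i); [field | rewrite e; field; apply/andP].
Qed.

(** The levels of this poset are fixed by [#|p.1|], which determines [#|p.2|],
    and its level sizes are the products of binomials in the sum.  When no
    member of [F] fills [V], deleting a uniformly random point of [V] keeps the
    expected weight of [F]; if some member fills [V] and another fills [W], the
    balance between the sizes forces the top element [(V, W)] to be in [F], so
    that [F] is this singleton. *)
Lemma lym_pairs (R : numFieldType) (T : finType) (V W : {set T}) (c d : nat)
    (F : {set {set T} * {set T}}) :
  (forall p, p \in F ->
     [/\ p.1 \subset V, p.2 \subset W & #|p.1| + c = #|p.2| + d]%N) ->
  (forall p q, p \in F -> q \in F -> p.1 \subset q.1 -> p.2 \subset q.2 -> p = q) ->
  \sum_(p in F) 'C(#|V|, #|p.1|)%:R^-1 * 'C(#|W|, #|p.2|)%:R^-1 <= 1 :> R.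
Proof.
move: (ltnSn (#|V| + #|W|)); move: {2}(_.+1) => s.
elim: s V W F => [//|s IH] V W F les sub anti.
have avg (U : {set T}) : #|U|%:R^-1 * \sum_(x in U) 1 <= 1 :> R.
  rewrite sumr_const; have [->|u0] := eqVneq (#|U|%:R : R) 0.
    by rewrite invr0 mul0r.
  by rewrite mulVf.
have [/exists_inP[p pF /eqP pV]|/exists_inPn nV] :=
  boolP [exists p in F, p.1 == V]; last first.
  rewrite (@sum_inv_bin_delete _ _ _ V F (fun p => p.1)) => [|p pF].
    apply: le_trans (avg V); rewrite ler_wpM2l ?invr_ge0 //.
    apply: ler_sum => x xV; apply: IH => [|p|p q].
    - by move: les; rewrite (cardsD1 x V) xV.
    - by rewrite inE => /andP[/sub[pV -> ->]]; rewrite subsetD1 pV => ->.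
    - by rewrite !inE => /andP[pF _] /andP[qF _]; apply: anti.
  by rewrite properEneq nV //; case: (sub p pF).
have [/exists_inP[q qF /eqP qW]|/exists_inPn nW] :=
  boolP [exists p in F, p.2 == W]; last first.
  under eq_bigr do rewrite mulrC.
  rewrite (@sum_inv_bin_delete _ _ _ W F (fun p => p.2)) => [|r rF].
    apply: le_trans (avg W); rewrite ler_wpM2l ?invr_ge0 //.
    apply: ler_sum => x xW; under eq_bigr do rewrite mulrC.
    apply: IH => [|r|r t].
    - by move: les; rewrite (cardsD1 x W) xW; lia.
    - by rewrite inE => /andP[/sub[-> rW ->]]; rewrite subsetD1 rW => ->.
    - by rewrite !inE => /andP[rF _] /andP[tF _]; apply: anti.
  by rewrite properEneq nW //; case: (sub r rF).
have [_ pW ep] := sub p pF; have [qV _ eq] := sub q qF.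
have {}pW : p.2 = W.
  apply/eqP; rewrite eqEcard pW /=.
  by rewrite -(leq_add2r d) -ep -qW -eq pV leq_add2r subset_leq_card.
rewrite (_ : F = [set p]); last first.
  apply/setP => r; rewrite inE; apply/idP/eqP => [rF|->//].
  by have [rV rW _] := sub r rF; apply: anti => //; rewrite ?pV ?pW.
by rewrite big_set1 pV pW !binn invr1 mulr1.
Qed.

(** * Antichains of the dominance order on sets of ordinals *)

Definition tail_count (n : nat) (X : {set 'I_n}) (z : nat) : nat :=
  #|[set x in X | (z <= x)%N]|.

(** For sets of the same size this is the Bruhat order of the Grassmannian: the
    [t]-th smallest element of [X] is at most that of [Y], for every [t]. *)
Definition dominated (n : nat) (X Y : {set 'I_n}) : Prop :=
  forall z : nat, (tail_count X z <= tail_count Y z)%N.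

Definition dominance_antichain (n : nat) (A : {set {set 'I_n}}) : Prop :=
  forall X Y, X \in A -> Y \in A -> dominated X Y -> X = Y.

Lemma tail_countU1 n (W : {set 'I_n}) x z :
  x \notin W -> tail_count (x |: W) z = ((z <= x) + tail_count W z)%N.
Proof.
move=> xW; rewrite /tail_count; have [zx|xz] := leqP z x.
  rewrite (_ : [set _ in _ | _] = x |: [set u in W | (z <= u)%N]).
    by rewrite cardsU1 !inE (negbTE xW).
  by apply/setP => u; rewrite !inE; case: eqP => // ->.
rewrite add0n; apply: eq_card => u; rewrite !inE.
by case: eqP => // ->; rewrite leqNgt xz (negbTE xW).
Qed.

Lemma antichain_exchange_unique n (A : {set {set 'I_n}}) (W : {set 'I_n}) x y :
  dominance_antichain A -> x \notin W -> y \notin W ->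
  x |: W \in A -> y |: W \in A -> x = y.
Proof.
move=> anti; wlog le_xy : x y / (x <= y)%N => [hw|] xW yW xA yA.
  by case: (leqP x y) => [|/ltnW] le; [exact: hw | apply/esym; exact: hw].
have e : x |: W = y |: W.
  apply: anti => // z; rewrite !tail_countU1 // leq_add2r.
  by case: (leqP z x) => // zx; rewrite (leq_trans zx le_xy).
by have := setU11 y W; rewrite -e !inE (negbTE yW) orbF => /eqP.
Qed.

(** A set reached by exchanging [x] for [y] remembers [x] once [y] is known,
    because the sets [x |: W] with [W] fixed form a chain.  Hence it is reached
    at most as many times as it has elements in [D]. *)
Lemma antichain_exchange_count n (A B : {set {set 'I_n}}) (D : {set 'I_n})
    (src : {set 'I_n} -> {set 'I_n}) (a b j : nat) :
  dominance_antichain A ->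
  (forall X, X \in A ->
     [/\ src X \subset X, a <= #|src X| & b <= #|D :\: X|]%N) ->
  (forall X x y, X \in A -> x \in src X -> y \in D :\: X ->
     y |: (X :\ x) \in B) ->
  (forall X, X \in B -> #|X :&: D| <= j)%N ->
  (#|A| * (a * b) <= #|B| * j)%N.
Proof.
move=> anti srcA AB Bj.
pose T1 := [set t : {set 'I_n} * ('I_n * 'I_n) |
  (t.1 \in A) && (t.2 \in setX (src t.1) (D :\: t.1))].
pose T2 := [set t : {set 'I_n} * 'I_n | (t.1 \in B) && (t.2 \in t.1 :&: D)].
have h1 : (#|A| * (a * b) <= #|T1|)%N.
  rewrite -sum_nat_const -sum1dep_card.
  rewrite -(pair_big_dep (mem A) (fun X p => p \in setX (src X) (D :\: X))
             (fun _ _ => 1%N)) /=.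
  apply: leq_sum => X /srcA[_ la lb]; rewrite sum1_card cardsX.
  exact: leq_mul.
have h2 : (#|T2| <= #|B| * j)%N.
  rewrite -sum_nat_const -sum1dep_card.
  rewrite -(pair_big_dep (mem B) (fun X p => p \in X :&: D) (fun _ _ => 1%N)) /=.
  by apply: leq_sum => X /Bj; rewrite sum1_card.
apply: leq_trans h1 (leq_trans _ h2).
pose f (t : {set 'I_n} * ('I_n * 'I_n)) := (t.2.2 |: (t.1 :\ t.2.1), t.2.2).
rewrite -(card_in_imset (_ : {in T1 &, injective f})).
  apply/subset_leq_card/subsetP => t /imsetP[[X [x y]]].
  rewrite !inE /= => /and3P[XA xs /andP[yX yD]] ->.
  by rewrite !inE eqxx yD (AB X) ?inE ?yX ?yD.
move=> [X [x y]] [X' [x' y']]; rewrite !inE /=.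
move=> /and3P[XA xs /andP[yX _]] /and3P[XA' xs' /andP[yX' _]] [eW ey].
subst y'.
have yW : y \notin X :\ x by rewrite !inE (negbTE yX) andbF.
have yW' : y \notin X' :\ x' by rewrite !inE (negbTE yX') andbF.
have {}eW : X :\ x = X' :\ x'.
  by rewrite -(setU1K yW) eW setU1K.
have xX : x \in X by case: (srcA X XA) => /subsetP sX _ _; apply: sX.
have xX' : x' \in X' by case: (srcA X' XA') => /subsetP sX _ _; apply: sX.
have exx : x = x'.
  apply: (antichain_exchange_unique (W := X :\ x) anti).
  - by rewrite !inE eqxx.
  - by rewrite eW !inE eqxx.
  - by rewrite setD1K.
  - by rewrite eW setD1K.
by rewrite -(setD1K xX) eW exx setD1K.
Qed.

(** * Swaps inside the middle block *)

Definition low n m : {set 'I_n} := [set i : 'I_n | (i < m)%N].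
Definition middle n m : {set 'I_n} := [set i : 'I_n | (m <= i < n - m)%N].
Definition high n m : {set 'I_n} := [set i : 'I_n | (n - m <= i)%N].

(** The enlarged family, which is compared with [A] from below by the number of
    exchanges and with the level sizes of the transfer poset from above. *)
Definition middle_swaps n m (A : {set {set 'I_n}}) : {set {set 'I_n}} :=
  [set X' | [exists X in A, [exists x in X :&: middle n m,
     [exists y in middle n m :\: X, X' == y |: (X :\ x)]]]].

Lemma middle_swapsP n m (A : {set {set 'I_n}}) X' :
  reflect (exists X x y, [/\ X \in A, x \in X :&: middle n m,
             y \in middle n m :\: X & X' = y |: (X :\ x)])
          (X' \in middle_swaps m A).
Proof.
rewrite inE; apply: (iffP exists_inP) => [[X XA]|[X [x [y [XA xX yX ->]]]]].
  case/exists_inP => x xX /exists_inP[y yX /eqP ->].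
  by exists X, x, y.
exists X => //; apply/exists_inP; exists x => //; apply/exists_inP.
by exists y.
Qed.

Lemma tail_count_swap n (X : {set 'I_n}) x y z :
  (tail_count (y |: (X :\ x)) z <= (tail_count X z).+1)%N.
Proof.
rewrite -add1n -(cards1 y); apply: leq_trans (leq_card_setU _ _).
apply/subset_leq_card/subsetP => u; rewrite !inE.
by case/andP => /orP[->//|/andP[_ ->]] ->; rewrite orbT.
Qed.

Lemma tail_count_compl n (X : {set 'I_n}) z :
  (tail_count X z + #|[set x in X | (x < z)%N]| = #|X|)%N.
Proof.
rewrite -(cardsID [set x : 'I_n | (z <= x)%N] X); congr (_ + _)%N.
  by apply: eq_card => x; rewrite !inE.
by apply: eq_card => x; rewrite !inE -ltnNge andbC.
Qed.

Lemma cards_low n m : (m <= n)%N -> #|low n m| = m.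
Proof.
move=> mn; have inj : injective (widen_ord mn).
  by move=> i j /(congr1 val) /= /val_inj.
rewrite -[RHS](card_ord m) -(card_imset _ inj).
apply: eq_card => i; rewrite inE; apply/idP/imsetP => [im|[j _ ->]].
  by exists (Ordinal im) => //; apply: val_inj.
exact: (ltn_ord j).
Qed.

Lemma cards_high n m : (m <= n)%N -> #|high n m| = m.
Proof.
move=> mn; rewrite -[RHS](cards_low mn) -(card_imset _ (@rev_ord_inj n)).
apply: eq_card => i; rewrite inE; apply/imsetP/idP => [[j]|im].
  by rewrite inE => jm -> /=; have := ltn_ord j; lia.
exists (rev_ord i); last by rewrite rev_ordK.
by rewrite inE /=; have := ltn_ord i; lia.
Qed.

Lemma card_low_middle_high n m (X : {set 'I_n}) : (m.*2 <= n)%N ->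
  (#|X| = #|X :&: low n m| + #|X :&: middle n m| + #|X :&: high n m|)%N.
Proof.
move=> mn; rewrite -(cardsID (low n m) X) -addnA; congr (_ + _)%N.
rewrite -(cardsID (middle n m) (X :\: _)); congr (_ + _)%N.
  by apply: eq_card => i; rewrite !inE; case: (i \in X); rewrite ?andbF //; lia.
by apply: eq_card => i; rewrite !inE; case: (i \in X); rewrite ?andbF //; lia.
Qed.

Lemma cards_middle n m : (m.*2 <= n)%N -> #|middle n m| = (n - m.*2)%N.
Proof.
move=> mn; have := card_low_middle_high setT mn.
rewrite cardsT card_ord !setTI cards_low ?cards_high; lia.
Qed.

(** A middle swap changes the tail counts by at most one, and only in the
    middle range, where moving two elements from the low block to the high one
    raises them by two.  So the dominance between the swapped sets survives when
    the swaps are undone. *)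
Lemma middle_swaps_no_jump n m k (A : {set {set 'I_n}}) (X1 X2 : {set 'I_n}) :
  dominance_antichain A -> (forall X, X \in A -> #|X| = k) -> (m.*2 <= n)%N ->
  X1 \in middle_swaps m A -> X2 \in middle_swaps m A ->
  X1 :&: middle n m = X2 :&: middle n m ->
  X2 :&: low n m \subset X1 :&: low n m ->
  X1 :&: high n m \subset X2 :&: high n m ->
  ~~ (#|X1 :&: high n m| + 2 <= #|X2 :&: high n m|)%N.
Proof.
move=> anti Ak mn /middle_swapsP[Z1 [x1 [y1 [Z1A xZ1 yZ1 e1]]]].
move=> /middle_swapsP[Z2 [x2 [y2 [Z2A xZ2 yZ2 e2]]]] emid slow shigh.
apply/negP => jump.
have outside Z x y i : x \in Z :&: middle n m -> y \in middle n m :\: Z ->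
    i \notin middle n m -> (i \in y |: (Z :\ x)) = (i \in Z).
  move=> /setIP[_ xm] /setDP[ym _] im; rewrite !inE.
  case: eqP => [ei|_]; first by move: im; rewrite ei ym.
  by case: eqP => [ei|_] //; move: im; rewrite ei xm.
have lowN (i : 'I_n) : (i < m)%N -> i \notin middle n m.
  by move=> im; rewrite !inE; lia.
have highN (i : 'I_n) : (n - m <= i)%N -> i \notin middle n m.
  by move=> im; rewrite !inE; lia.
have dom : dominated Z1 Z2.
  move=> z; have [zm|mz] := leqP z m.
    rewrite -(leq_add2r #|[set x in Z1 | (x < z)%N]|) tail_count_compl.
    rewrite (Ak _ Z1A) -(Ak _ Z2A) -(tail_count_compl Z2 z) leq_add2l.
    apply/subset_leq_card/subsetP => i; rewrite !inE => /andP[iZ iz].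
    have im : (i < m)%N by apply: leq_trans iz zm.
    move: (subsetP slow i); rewrite !inE im iz !andbT e1 e2.
    by rewrite !outside ?lowN // => ->.
  have [zh|hz] := leqP (n - m) z.
    apply/subset_leq_card/subsetP => i; rewrite !inE => /andP[iZ zi].
    have im : (n - m <= i)%N by apply: leq_trans zh zi.
    move: (subsetP shigh i); rewrite !inE im zi !andbT e1 e2.
    by rewrite !outside ?highN // => ->.
  have split X : tail_count X z =
      (tail_count (X :&: middle n m) z + #|X :&: high n m|)%N.
    rewrite /tail_count -[LHS](cardsID (middle n m)); congr (_ + _)%N.
      by apply: eq_card => i; rewrite !inE andbAC.
    apply: eq_card => i; rewrite !inE.
    by case: (i \in X); rewrite ?andbF //=; lia.
  have s1 := tail_count_swap X1 y1 x1 z; have s2 := tail_count_swap Z2 x2 y2 z.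
  have eZ1 : x1 |: (X1 :\ y1) = Z1.
    move: xZ1 yZ1 => /setIP[xZ _] /setDP[_ yZ].
    by rewrite e1 setU1K ?setD1K // !inE negb_and yZ orbT.
  rewrite eZ1 in s1; rewrite -e2 in s2; move: s1 s2.
  by rewrite !(split X1, split X2) emid; lia.
have e := anti _ _ Z1A Z2A dom.
have : X1 :&: high n m = X2 :&: high n m.
  apply/setP => i; rewrite !inE; case: leqP => im; rewrite ?andbF // !andbT.
  by rewrite e1 e2 !outside ?highN // e.
by move: jump => /[swap] ->; lia.
Qed.

Lemma middle_swaps_card n m k j (A : {set {set 'I_n}}) X :
  (forall Z, Z \in A -> #|Z| = k) ->
  (forall Z, Z \in A -> #|Z :&: middle n m| = j) ->
  X \in middle_swaps m A -> #|X| = k /\ #|X :&: middle n m| = j.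
Proof.
move=> Ak Aj /middle_swapsP[Z [x [y [ZA /setIP[xZ xm] /setDP[ym yZ] ->]]]].
have card_swap (U : {set 'I_n}) : x \in U -> y \notin U -> #|y |: (U :\ x)| = #|U|.
  by move=> xU yU; rewrite cardsU1 (cardsD1 x U) xU !inE (negbTE yU) andbF.
split; first by rewrite card_swap ?Ak.
rewrite -(Aj Z ZA) -(card_swap (Z :&: middle n m)) ?in_setI ?xZ ?(negbTE yZ) //.
apply: eq_card => i; rewrite !inE.
case: eqP => [->|_] /=; last by rewrite -andbA.
by move: ym; rewrite !inE => /andP[-> ->].
Qed.

(** Encoding a set by its low part and the complement of its high part turns a
    transfer into the removal of one point from each component.  Two comparable
    members differ by a single transfer, so that those whose low parts have
    sizes of a given parity form an antichain. *)
Lemma card_middle_swaps_fibre (R : numFieldType) n m k j (A : {set {set 'I_n}})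
    (G : R) (Y : {set 'I_n}) (parity : bool) :
  dominance_antichain A -> (m.*2 <= n)%N ->
  (forall X, X \in A -> #|X| = k) ->
  (forall X, X \in A -> #|X :&: middle n m| = j) ->
  (forall a, (a <= k - j)%N -> (a <= m)%N -> (k - j - a <= m)%N ->
     ('C(m, a) * 'C(m, k - j - a))%:R <= G) ->
  0 <= G ->
  #|[set X in middle_swaps m A |
      (X :&: middle n m == Y) && (odd #|X :&: low n m| == parity)]|%:R <= G.
Proof.
move=> anti mn Ak Aj Gbin G0; set S := [set X in _ | _].
have mn' : (m <= n)%N by lia.
have cS X : X \in S -> [/\ (#|X :&: low n m| + #|X :&: high n m| = k - j)%N,
    X \in middle_swaps m A, X :&: middle n m = Y &
    odd #|X :&: low n m| = parity].
  rewrite inE => /and3P[XB /eqP-> /eqP->]; split => //.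
  have [<- <-] := middle_swaps_card Ak Aj XB.
  by rewrite (card_low_middle_high X mn); lia.
have ch X : (#|high n m :\: X| + #|X :&: high n m| = m)%N.
  by rewrite -[RHS](cards_high mn') -(cardsID X (high n m)) addnC setIC.
pose phi (X : {set 'I_n}) := (X :&: low n m, high n m :\: X).
have phi_inj : {in S &, injective phi}.
  move=> X X' /cS[_ _ XY _] /cS[_ _ XY' _] [elo ehi].
  apply/setP => i; have [im|mi] := ltnP i m.
    by move/setP/(_ i): elo; rewrite !inE im !andbT.
  have [ih|hi] := leqP (n - m) i.
    by move/setP/(_ i): ehi; rewrite !inE ih !andbT; apply: negb_inj.
  by move: XY; rewrite -XY' => /setP/(_ i); rewrite !inE mi hi !andbT.
have trade a b c d l : (a + b = l -> c + b = d -> a + d = c + l)%N by lia.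
have phiP p : p \in phi @: S -> exists2 X : {set 'I_n}, X \in S & p = phi X.
  by case/imsetP => X; exists X.
have := @lym_pairs R _ (low n m) (high n m) m (k - j) (phi @: S).
rewrite (cards_low mn') (cards_high mn') big_imset //= => lym.
have {}lym : \sum_(X in S) 'C(m, #|X :&: low n m|)%:R^-1 *
                'C(m, #|high n m :\: X|)%:R^-1 <= 1 :> R.
  apply: lym => [p /phiP[X /cS[cX _ _ _] ->] /=|].
    rewrite subsetIr subsetDl; split => //.
    exact: trade cX (ch X).
  move=> p q /phiP[X XS ->] /phiP[X' XS' ->] /= slo shi.
  have [cX XB XY oX] := cS X XS; have [cX' XB' XY' oX'] := cS X' XS'.
  have shi' : X' :&: high n m \subset X :&: high n m.
    apply/subsetP => i; rewrite !inE => /andP[iX' ih].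
    by move/subsetP/(_ i): shi; rewrite !inE ih iX' andbT; case: (i \in X) => // ->.
  have := middle_swaps_no_jump anti Ak mn XB' XB _ slo shi'.
  rewrite XY XY' => /(_ erefl); rewrite -ltnNge => lt2.
  have le2 := subset_leq_card shi'.
  (* The parity constraint excludes a jump of exactly one element. *)
  have eo : odd (#|X :&: low n m| + #|X' :&: low n m|) = false.
    by rewrite oddD oX oX' addbb.
  have [e1 e2] : #|X :&: low n m| = #|X' :&: low n m| /\
                 #|X :&: high n m| = #|X' :&: high n m|.
    by move: eo cX cX' lt2 le2; clear; lia.
  congr phi; apply: phi_inj => //; congr pair; apply/eqP.
    by rewrite eqEcard slo e1 /=.
  by rewrite eqEcard shi /= -(leq_add2r #|X :&: high n m|) {1}e2 !ch.
have binG X : X \in S -> 1 <= G * ('C(m, #|X :&: low n m|)%:R^-1 *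
                                      'C(m, #|high n m :\: X|)%:R^-1).
  move=> /cS[cX _ _ _].
  have lm : (#|X :&: low n m| <= m)%N.
    by rewrite -[leqRHS](cards_low mn') subset_leq_card ?subsetIr.
  have hm := ch X.
  have -> : 'C(m, #|high n m :\: X|) = 'C(m, k - j - #|X :&: low n m|).
    by rewrite -bin_sub; [congr 'C(m, _); lia | lia].
  rewrite -invfM -natrM ler_pdivlMr ?mul1r; first by apply: Gbin; lia.
  by rewrite ltr0n muln_gt0 !bin_gt0; lia.
apply: (@le_trans _ _ (\sum_(X in S) (G * ('C(m, #|X :&: low n m|)%:R^-1 *
                                      'C(m, #|high n m :\: X|)%:R^-1)))).
  by rewrite -sum1_card natr_sum; apply: ler_sum.
by rewrite -mulr_sumr -[leRHS]mulr1 ler_wpM2l.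
Qed.

(** There are ['C(n - m.*2, j)] middle parts, and two parities for each. *)
Lemma card_middle_swaps (R : numFieldType) n m k j (A : {set {set 'I_n}}) (G : R) :
  dominance_antichain A -> (m.*2 <= n)%N ->
  (forall X, X \in A -> #|X| = k) ->
  (forall X, X \in A -> #|X :&: middle n m| = j) ->
  (forall a, (a <= k - j)%N -> (a <= m)%N -> (k - j - a <= m)%N ->
     ('C(m, a) * 'C(m, k - j - a))%:R <= G) ->
  0 <= G ->
  #|middle_swaps m A|%:R <= 'C(n - m.*2, j)%:R * (2 * G).
Proof.
move=> anti mn Ak Aj Gbin G0.
pose S (Y : {set 'I_n}) (e : bool) := [set X in middle_swaps m A |
  (X :&: middle n m == Y) && (odd #|X :&: low n m| == e)].
have cover : (#|middle_swaps m A| <=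
    \sum_(Y : {set 'I_n} | (Y \subset middle n m) && (#|Y| == j))
      \sum_(e : bool) #|S Y e|)%N.
  rewrite -sum1_card.
  rewrite (partition_big (fun X => X :&: middle n m)
    (fun Y => (Y \subset middle n m) && (#|Y| == j))) /=; last first.
    move=> X XB; rewrite subsetIr.
    by have [_ ->] := middle_swaps_card Ak Aj XB; rewrite eqxx.
  apply: leq_sum => Y _.
  rewrite (partition_big (fun X => odd #|X :&: low n m|) predT) //=.
  apply: leq_sum => e _; rewrite sum1dep_card; apply: subset_leq_card.
  by apply/subsetP => X; rewrite !inE andbA.
apply: (@le_trans _ _ (\sum_(Y : {set 'I_n} | (Y \subset middle n m) && (#|Y| == j))
      \sum_(e : bool) #|S Y e|)%N%:R); first by rewrite ler_nat.
have sizeY : #|[set Y : {set 'I_n} | (Y \subset middle n m) && (#|Y| == j)]| =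
             'C(n - m.*2, j) by rewrite cards_draws cards_middle.
rewrite -sizeY -sum1dep_card !natr_sum mulr_suml; apply: ler_sum => Y _.
rewrite mul1r natr_sum big_bool /= mulr_natl mulr2n.
by apply: lerD; apply: (card_middle_swaps_fibre _ _ anti mn Ak Aj Gbin).
Qed.

(** * The size of a dominance antichain *)

(** [hypergeom_sq] with the square root linearized by the inequality of the
    means: [sqrt (2 * t) <= s * t + (2 * s)^-1].  The free parameter [s] will be
    [sqrt k.+1], the order of magnitude that makes both terms comparable after
    averaging over [l]. *)
Lemma hypergeom_le (R : realFieldType) m l a (s : R) :
  0 < s -> (a <= l)%N -> (a <= m)%N -> (l - a <= m)%N ->
  ('C(m, a) * 'C(m, l - a))%:R <=
  'C(m.*2, l)%:R * (s * (l.+1%:R^-1 + (m.*2 - l).+1%:R^-1) + (2 * s)^-1).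
Proof.
move=> s0 al am lam.
have := hypergeom_sq al am lam.
rewrite -(ler_nat R) natrM natrX [(l.+1 * _)%:R]natrM [leRHS]natrM natrX.
set u := (_ * _)%N%:R; set c := 'C(m.*2, l)%:R.
have p0 : 0 < l.+1%:R :> R by rewrite ltr0n.
have q0 : 0 < (m.*2 - l).+1%:R :> R by rewrite ltr0n.
have pq : (4 * m).+1%:R <= 2 * (l.+1%:R + (m.*2 - l).+1%:R) :> R.
  by rewrite -natrD -natrM ler_nat; lia.
move: p0 q0 pq; move: (l.+1)%:R (m.*2 - l).+1%:R (4 * m).+1%:R => p q r p0 q0 pq h.
have c0 : 0 <= c by rewrite ler0n.
have u0 : 0 <= u by rewrite ler0n.
set t := p^-1 + q^-1.
have t0 : 0 < t by rewrite addr_gt0 ?invr_gt0.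
have ut : u ^+ 2 <= c ^+ 2 * (2 * t).
  rewrite -(ler_pM2r (mulr_gt0 p0 q0)); apply: le_trans h _.
  have -> : c ^+ 2 * (2 * t) * (p * q) = c ^+ 2 * (2 * (p + q)).
    by rewrite /t; field; rewrite !gt_eqF.
  by rewrite ler_wpM2l ?sqr_ge0.
have rhs0 : 0 <= s * t + (2 * s)^-1.
  by rewrite addr_ge0 ?mulr_ge0 ?invr_ge0 ?mulr_ge0 // ltW.
rewrite -(@ler_pXn2r _ 2) ?nnegrE ?mulr_ge0 // exprMn.
apply: le_trans ut _; rewrite ler_wpM2l ?sqr_ge0 // -subr_ge0.
have -> : (s * t + (2 * s)^-1) ^+ 2 - 2 * t = (s * t - (2 * s)^-1) ^+ 2.
  by field; rewrite gt_eqF.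
exact: sqr_ge0.
Qed.

(** Both reciprocals are absorbed by the binomial coefficient, raising its upper
    index by one: this is the computation of the expectation of [1 / (l + 1)] for
    a hypergeometric variable [l]. *)
Lemma sum_bin_inv_le (R : realFieldType) (d e k : nat) :
  (k.*2 <= d + e)%N ->
  \sum_(j < k.+1) 'C(d, j)%:R * 'C(e, k - j)%:R *
     ((k - j).+1%:R^-1 + (e - (k - j)).+1%:R^-1)
  <= 2 * 'C(d + e, k)%:R * (d + e).+1%:R / (k.+1%:R * e.+1%:R) :> R.
Proof.
move=> kde.
have e0 : e.+1%:R != 0 :> R by rewrite pnatr_eq0.
have up l : 'C(e, l)%:R / l.+1%:R = 'C(e.+1, l.+1)%:R / e.+1%:R :> R.
  apply/eqP; rewrite eqr_div ?pnatr_eq0 // -!natrM mulnC.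
  by rewrite (mul_bin_diag e.+1 l) mulnC.
have stay l : 'C(e, l)%:R / (e - l).+1%:R <= 'C(e.+1, l)%:R / e.+1%:R :> R.
  have [le|el] := leqP l e; last by rewrite bin_small // mul0r divr_ge0.
  rewrite le_eqVlt eqr_div ?pnatr_eq0 // -!natrM mulnC (mul_bin_down e.+1 l).
  by rewrite subSn // mulnC eqxx.
have V1 : (\sum_(j < k.+1) 'C(d, j) * 'C(e.+1, (k - j).+1) <= 'C((d + e).+1, k.+1))%N.
  rewrite -addnS -binomial.Vandermonde [leqRHS]big_ord_recr /=.
  apply: leq_trans (leq_addr _ _); apply: leq_sum => j _.
  by rewrite -subSn // -ltnS.
have V2 : (\sum_(j < k.+1) 'C(d, j) * 'C(e.+1, k - j) = 'C((d + e).+1, k))%N.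
  by rewrite -addnS -binomial.Vandermonde.
apply: (@le_trans _ _ (('C((d + e).+1, k.+1) + 'C((d + e).+1, k))%:R / e.+1%:R)).
  apply: (@le_trans _ _ ((\sum_(j < k.+1) 'C(d, j) * 'C(e.+1, (k - j).+1) +
     \sum_(j < k.+1) 'C(d, j) * 'C(e.+1, k - j))%N%:R / e.+1%:R)); last first.
    by rewrite ler_wpM2r ?invr_ge0 // ler_nat V2 leq_add2r.
  rewrite -big_split natr_sum mulr_suml; apply: ler_sum => j _ /=.
  rewrite -mulrA mulrDr up natrD !natrM mulrDl -!mulrA -mulrDr.
  by rewrite ler_wpM2l // lerD2l.
rewrite invfM mulrA ler_wpM2r ?invr_ge0 //.
have b1 : 'C((d + e).+1, k.+1)%:R = 'C(d + e, k)%:R * (d + e).+1%:R / k.+1%:R :> R.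
  rewrite -natrM mulnC (mul_bin_diag (d + e).+1 k) natrM mulrC mulKf //.
  by rewrite pnatr_eq0.
have b2 : 'C((d + e).+1, k)%:R <= 'C(d + e, k)%:R * (d + e).+1%:R / k.+1%:R :> R.
  rewrite ler_pdivlMr ?ltr0n // -!natrM ler_nat [leqRHS]mulnC.
  by rewrite (mul_bin_down (d + e).+1 k) mulnC leq_mul2r; apply/orP; right; lia.
by rewrite natrD -!mulrA mulr_natl mulr2n !mulrA lerD // b1.
Qed.

(** The bound sums, over the size [j] of the middle part, the bounds for the sets
    of [A] with this size.  The constant is [3 + 8 * (16 + 1 / 2)]: the term [3]
    is for [j = 0]; the factor [8] combines the [n / 4] exchanges and the two
    parities; [16] and [1 / 2] come from the two terms of [hypergeom_le]. *)
Lemma dominance_antichain_card (R : rcfType) n k (A : {set {set 'I_n}}) :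
  (0 < k)%N -> (k.*2 <= n)%N -> (forall X, X \in A -> #|X| = k) ->
  dominance_antichain A ->
  n%:R * #|A|%:R <= 135 * 'C(n, k)%:R / Num.sqrt k.+1%:R :> R.
Proof.
move=> k0 kn Ak anti.
(* The middle block has at least [3 n / 4] elements, and at most [k <= n / 2] of
   them are in a set of [A], so that at least [n / 4] can be brought in; the
   outer blocks still contain a fixed proportion of [n]. *)
pose m := (n %/ 8)%N; pose d := (n - m.*2)%N.
have mn : (m.*2 <= n)%N by rewrite /m; lia.
have dn : (d + m.*2 = n)%N by rewrite /d; lia.
have d34 : (3 * n <= 4 * d)%N by rewrite /d /m; lia.
have m8 : (n.+1 <= 8 * (m.*2).+1)%N by rewrite /m; lia.
pose s : R := Num.sqrt k.+1%:R.
have s0 : 0 < s by rewrite sqrtr_gt0 ltr0n.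
have s2 : s * s = k.+1%:R by rewrite -expr2 sqr_sqrtr ?ler0n.
pose G l : R :=
  'C(m.*2, l)%:R * (s * (l.+1%:R^-1 + (m.*2 - l).+1%:R^-1) + (2 * s)^-1).
have G0 l : 0 <= G l.
  have s0' := ltW s0.
  by rewrite mulr_ge0 // addr_ge0 ?mulr_ge0 ?addr_ge0 ?invr_ge0 ?mulr_ge0.
pose Aj j := [set X in A | #|X :&: middle n m| == j].
have antij j : dominance_antichain (Aj j).
  by move=> X Y; rewrite !inE => /andP[XA _] /andP[YA _]; apply: anti.
have Ajk j X : X \in Aj j -> #|X| = k by rewrite inE => /andP[/Ak].
have Ajj j X : X \in Aj j -> #|X :&: middle n m| = j.
  by rewrite inE => /andP[_ /eqP].
have diff j X : X \in Aj j -> #|middle n m :\: X| = (d - j)%N.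
  by move=> /Ajj <-; rewrite cardsD cards_middle // setIC.
have step0 : n%:R * #|Aj 0|%:R <= 3 * 'C(n, k)%:R / s.
  have h : (#|Aj 0%N| * (k * d) <= 'C(n, k))%N.
    pose B := [set X : {set 'I_n} | (#|X| == k) && (#|X :&: middle n m| == 1%N)].
    have cB : (#|B| <= 'C(n, k))%N.
      rewrite -[X in 'C(X, _)](card_ord n) -card_draws.
      by apply/subset_leq_card/subsetP => X; rewrite !inE => /andP[].
    apply: leq_trans cB; rewrite -[leqRHS]muln1.
    apply: (antichain_exchange_count (D := middle n m) (src := id) (antij 0%N)).
    - by move=> X XA; rewrite (Ajk _ _ XA) (diff _ _ XA) subn0.
    - move=> X x y XA xX /setDP[ym yX].
      (* The only middle element of the new set is [y]. *)
      have X0 : X :&: middle n m = set0 by apply/eqP; rewrite -cards_eq0 (Ajj _ _ XA).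
      rewrite inE cardsU1 !in_setD1 (negbTE yX) andbF /=.
      have := Ajk _ _ XA; rewrite (cardsD1 x X) xX => -> /=; rewrite eqxx /=.
      rewrite (_ : _ :&: _ = [set y]) ?cards1 //; apply/setP => i.
      have := in_set0 i; rewrite -X0 !in_setI in_setU1 in_setD1 in_set1.
      by have [->|_] := eqVneq i y; rewrite ?ym //= -andbA => ->; rewrite andbF.
    - by move=> X; rewrite inE => /andP[_ /eqP->].
  rewrite ler_pdivlMr //.
  have sk : s <= 2 * k%:R.
    rewrite -(@ler_pXn2r _ 2) ?nnegrE ?mulr_ge0 ?(ltW s0) // expr2 s2.
    by rewrite -natrM -natrX ler_nat -mulnn; nia.
  apply: (@le_trans _ _ (n%:R * #|Aj 0%N|%:R * (2 * k%:R))).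
    by rewrite ler_wpM2l ?mulr_ge0.
  rewrite -!natrM ler_nat; move: h; set b := 'C(n, k); set a := #|_|.
  nia.
have stepj j : (0 < j)%N -> (j <= k)%N ->
    n%:R * #|Aj j|%:R <= 8 * ('C(d, j)%:R * G (k - j)%N).
  move=> j0 jk.
  have h1 : (#|Aj j| * (j * (d - j)) <= #|middle_swaps m (Aj j)| * j)%N.
    apply: (antichain_exchange_count (D := middle n m)
              (src := fun X => X :&: middle n m) (antij j)).
    - by move=> X XA; rewrite subsetIl (Ajj _ _ XA) (diff _ _ XA).
    - by move=> X x y XA xX yX; apply/middle_swapsP; exists X, x, y.
    - by move=> X /(middle_swaps_card (Ajk j) (Ajj j))[_ ->].
  have h2 : (n * #|Aj j| <= 4 * #|middle_swaps m (Aj j)|)%N.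
    have {}h1 : (#|Aj j| * (d - j) <= #|middle_swaps m (Aj j)|)%N.
      by rewrite -(leq_pmul2r j0) -mulnA [((d - j) * j)%N]mulnC.
    apply: (@leq_trans (4 * (#|Aj j| * (d - j)))); last by rewrite leq_mul2l h1.
    by rewrite mulnC mulnCA leq_mul2l; apply/orP; right; lia.
  have h3 := card_middle_swaps (antij j) mn (Ajk j) (Ajj j) (G := G (k - j)%N).
  have {}h3 : #|middle_swaps m (Aj j)|%:R <= 'C(d, j)%:R * (2 * G (k - j)%N).
    by apply: h3 => [a|]; [exact: hypergeom_le | exact: G0].
  move: h2; rewrite -(ler_nat R) !natrM; move: h3; lra.
have split : n%:R * #|A|%:R = \sum_(j < k.+1) n%:R * #|Aj j|%:R :> R.
  rewrite -mulr_sumr -natr_sum; congr (_ * _%:R); rewrite -sum1_card.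
  rewrite (partition_big (fun X => inord #|X :&: middle n m| : 'I_k.+1) predT) //=.
  apply: eq_bigr => j _; rewrite sum1dep_card; apply: eq_card => X.
  rewrite !inE; case XA: (X \in A) => //=; rewrite -val_eqE /= inordK //.
  by rewrite ltnS -(Ak X XA) subset_leq_card ?subsetIl.
rewrite split big_ord_recl /=.
apply: (@le_trans _ _ (3 * 'C(n, k)%:R / s +
   8 * \sum_(j < k.+1) 'C(d, j)%:R * G (k - j)%N)).
  apply: lerD => //; rewrite [X in 8 * X]big_ord_recl /= mulrDr.
  apply: (@le_trans _ _ (8 * \sum_(i < k) 'C(d, bump 0 i)%:R * G (k - bump 0 i)%N)).
    by rewrite mulr_sumr; apply: ler_sum => i _; apply: stepj.
  by rewrite lerDr; do 2?apply: mulr_ge0.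
have sumG : \sum_(j < k.+1) 'C(d, j)%:R * G (k - j)%N =
   s * (\sum_(j < k.+1) 'C(d, j)%:R * 'C(m.*2, k - j)%:R *
     ((k - j).+1%:R^-1 + (m.*2 - (k - j)).+1%:R^-1)) + 'C(n, k)%:R * (2 * s)^-1.
  rewrite -[in 'C(n, k)]dn -binomial.Vandermonde natr_sum mulr_sumr mulr_suml -big_split.
  by apply: eq_bigr => j _ /=; rewrite /G natrM; ring.
have kdm : (k.*2 <= d + m.*2)%N by rewrite dn.
have := sum_bin_inv_le R kdm; rewrite dn sumG.
set S := \sum_(j < _) _; set c := 'C(n, k)%:R => hS.
have {}hS : S <= 16 * c / (s * s).
  apply: le_trans hS _; rewrite s2 ler_pdivrMr ?mulr_gt0 ?ltr0n //.
  have -> : 16 * c / k.+1%:R * (k.+1%:R * m.*2.+1%:R) = 2 * c * (8 * m.*2.+1%:R).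
    by rewrite mulrA divfK ?pnatr_eq0 //; ring.
  by rewrite ler_wpM2l ?mulr_ge0 // -natrM ler_nat.
have -> : 135 * c / s = 3 * c / s + 8 * (s * (16 * c / (s * s)) + c * (2 * s)^-1).
  by field; rewrite gt_eqF.
by rewrite lerD2l ler_wpM2l // lerD2r ler_wpM2l // ltW.
Qed.

(** * Level sets of a linear form on permutations *)

Lemma card_cond_enum n (X : {set 'I_n}) (P : pred nat) :
  #|[set x in X | P x]| = count P (map val (enum X)).
Proof.
rewrite count_map -sum1_count big_enum_cond /= sum1dep_card.
by apply: eq_card => x; rewrite !inE.
Qed.

Lemma enum_set_sorted n (X : {set 'I_n}) : sorted <%O (map val (enum X)).
Proof.
apply: (@subseq_sorted _ _ lt_trans _ (map val (enum 'I_n))).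
  by apply: map_subseq; rewrite enumT; exact: filter_subseq.
by rewrite val_enum_ord iota_ltn_sorted.
Qed.

Lemma dominated_nth n (X Y : {set 'I_n}) (x0 : 'I_n) t :
  #|X| = #|Y| -> dominated X Y -> (t < #|X|)%N ->
  (nth x0 (enum X) t <= nth x0 (enum Y) t)%N.
Proof.
move=> eXY dom tX; have tY : (t < #|Y|)%N by rewrite -eXY.
rewrite leqNgt; apply/negP; set a := nth x0 (enum X) t; set b := nth _ _ _ => ba.
have ea : val a = nth (val x0) (map val (enum X)) t.
  by rewrite (nth_map x0) -?cardE.
have eb : val b = nth (val x0) (map val (enum Y)) t.
  by rewrite (nth_map x0) -?cardE.
have cX : #|[set x in X | (x < a)%N]| = t.
  have := count_lt_nth (val x0) (enum_set_sorted X); rewrite size_map -cardE.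
  by move=> /(_ t tX); rewrite -ea (card_cond_enum X (fun i => (i < a)%N)).
have cY : (t < #|[set y in Y | (y < a)%N]|)%N.
  rewrite (card_cond_enum _ (fun i => (i < a)%N)).
  have := count_le_nth (val x0) (enum_set_sorted Y); rewrite size_map -cardE.
  move=> /(_ t tY); rewrite -eb => <-.
  by apply: sub_count => i /= ib; apply: leq_ltn_trans ib ba.
have := dom a; have := tail_count_compl X a; have := tail_count_compl Y a.
by rewrite cX; move: cY eXY tX; lia.
Qed.

Lemma dominated_setC n (X Y : {set 'I_n}) :
  dominated X Y -> dominated (~: Y) (~: X).
Proof.
move=> dom z; have compl (Z : {set 'I_n}) :
    (tail_count Z z + tail_count (~: Z) z = tail_count [set: 'I_n] z)%N.
  rewrite /tail_count -[RHS](cardsID Z); congr (_ + _)%N.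
    by apply: eq_card => x; rewrite !inE andbC.
  by apply: eq_card => x; rewrite !inE.
by have := dom z; have := compl X; have := compl Y; lia.
Qed.

Lemma arrange_inj n (X : {set 'I_n}) :
  injective (fun t : 'I_n => nth t (enum X ++ enum (~: X)) t).
Proof.
have sz : size (enum X ++ enum (~: X)) = n.
  by rewrite size_cat -!cardE cardsC card_ord.
move=> t u /=; rewrite (set_nth_default u) ?sz ?ltn_ord // => /eqP.
rewrite nth_uniq ?sz ?ltn_ord // => [/eqP/val_inj//|].
rewrite cat_uniq !enum_uniq andbT /=; apply/hasPn => x.
by rewrite !mem_enum inE.
Qed.

(** Moving [X] up in the dominance order raises the first [#|X|] entries and
    lowers the others. *)
Definition arrange n (X : {set 'I_n}) : 'S_n := perm (@arrange_inj n X).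

Lemma arrange_mem n (X : {set 'I_n}) (t : 'I_n) :
  (arrange X t \in X) = (t < #|X|)%N.
Proof.
rewrite permE nth_cat -cardE; case: ltnP => tX.
  by rewrite -mem_enum mem_nth -?cardE.
apply/negbTE; rewrite -in_setC -mem_enum mem_nth // -cardE.
by rewrite ltn_subLR // cardsC card_ord.
Qed.

Lemma arrange_low n (X Y : {set 'I_n}) (t : 'I_n) :
  #|X| = #|Y| -> dominated X Y -> (t < #|X|)%N -> (arrange X t <= arrange Y t)%N.
Proof.
move=> eXY dom tX; rewrite !permE !nth_cat -!cardE -eXY tX.
exact: dominated_nth.
Qed.

Lemma arrange_high n (X Y : {set 'I_n}) (t : 'I_n) :
  #|X| = #|Y| -> dominated X Y -> (#|X| <= t)%N -> (arrange Y t <= arrange X t)%N.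
Proof.
move=> eXY dom tX; rewrite !permE !nth_cat -!cardE -eXY ltnNge tX /=.
have eC : #|~: Y| = #|~: X|.
  by apply/eqP; rewrite -(eqn_add2l #|Y|) cardsC -eXY cardsC.
apply: dominated_nth => //; first exact: dominated_setC.
by rewrite eC ltn_subLR // cardsC card_ord.
Qed.

(** Subtracting the threshold from the weights changes both sums by the same
    amount, namely by a multiple of the sum of all the [v i].  Afterwards the
    elements of the set, which move up, carry positive weights, and those of the
    complement, which move down, carry nonpositive ones. *)
Lemma arranged_sum_lt (R : realDomainType) n (a v : 'I_n -> R) (theta : R)
    (X Y : {set 'I_n}) :
  (forall i j : 'I_n, (i < j)%N -> v i < v j) ->
  (forall t : 'I_n, (theta < a t) = (t < #|X|)%N) ->
  #|X| = #|Y| -> dominated X Y -> X != Y ->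
  \sum_t a t * v (arrange X t) < \sum_t a t * v (arrange Y t).
Proof.
move=> v_inc aX eXY dom nXY.
have v_le (i j : 'I_n) : (i <= j)%N -> v i <= v j.
  by rewrite leq_eqVlt => /orP[/eqP/val_inj->|/v_inc/ltW].
have total (Z : {set 'I_n}) : \sum_t v (arrange Z t) = \sum_t v t.
  by rewrite [RHS](reindex_inj (@perm_inj _ (arrange Z))).
pose D t := (a t - theta) * (v (arrange Y t) - v (arrange X t)).
have eD : \sum_t a t * v (arrange Y t) - \sum_t a t * v (arrange X t) = \sum_t D t.
  transitivity (\sum_t a t * v (arrange Y t) - \sum_t a t * v (arrange X t) -
     theta * (\sum_t v (arrange Y t) - \sum_t v (arrange X t))).
    by rewrite !total subrr mulr0 subr0.
  rewrite -!sumrB mulr_sumr -sumrB; apply: eq_bigr => t _; rewrite /D.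
  by ring.
have D0 t : 0 <= D t.
  rewrite /D; have [tX|Xt] := ltnP t #|X|.
    by rewrite mulr_ge0 // subr_ge0 ?v_le ?arrange_low // ltW // aX.
  by rewrite mulr_le0 // subr_le0 ?v_le ?arrange_high // leNgt aX -leqNgt.
rewrite -subr_gt0 eD lt_def sumr_ge0 // andbT.
apply: contraNneq nXY => /eqP; rewrite psumr_eq0 // => /allP D_eq0.
have same (t : 'I_n) : (t < #|X|)%N -> arrange X t = arrange Y t.
  move=> tX; have := D_eq0 t; rewrite mem_index_enum => /(_ isT) /=.
  rewrite mulf_eq0 !subr_eq0 gt_eqF ?aX //= => /eqP ev; apply: val_inj.
  apply/eqP; rewrite eqn_leq arrange_low //= leqNgt; apply/negP => /v_inc.
  by rewrite ev ltxx.
rewrite eqEcard eXY leqnn andbT; apply/subsetP => x xX.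
pose t := ((arrange X)^-1)%g x; have et : arrange X t = x by rewrite permKV.
have tX : (t < #|X|)%N by rewrite -arrange_mem et.
by rewrite -et same // arrange_mem -eXY.
Qed.

(** A permutation [s] is determined by the preimage [X] of the large weights
    and by [arrange X * s], which ranges over permutations that do not depend
    on [X].  With the latter fixed, the linear form is a strictly monotone
    function of [X], so that its level sets are antichains. *)
Lemma perm_level_card_increasing (R : rcfType) n (v w : 'I_n -> R)
    (theta x : R) (k : nat) :
  (forall i j : 'I_n, (i < j)%N -> v i < v j) ->
  k = #|[set i | theta < w i]| -> (0 < k)%N -> (k.*2 <= n)%N ->
  n%:R * #|[set s : 'S_n | \sum_i w (s i) * v i == x]|%:R
    <= 135 * n`!%:R / Num.sqrt k.+1%:R :> R.
Proof.
move=> v_inc ek k0 kn.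
pose H : {set 'I_n} := [set i | theta < w i].
pose Gam : {set 'S_n} := [set g : 'S_n | [forall t, (g t \in H) == (t < k)%N]].
pose ksets : {set {set 'I_n}} := [set X : {set 'I_n} | #|X| == k].
pose F (g : 'S_n) (X : {set 'I_n}) := \sum_t w (g t) * v (arrange X t).
pose pre (s : 'S_n) := [set i | s i \in H].
have pre_k s : #|pre s| = k.
  rewrite ek -(card_imset _ (@perm_inj _ s)); apply: eq_card => i.
  apply/imsetP/idP => [[j + ->]|iH]; first by rewrite !inE.
  by exists ((s^-1)%g i); rewrite ?permKV // inE permKV.
have pre_Gam (s : 'S_n) (X : {set 'I_n}) : #|X| = k ->
    ((arrange X * s)%g \in Gam) = (pre s == X).
  move=> Xk; rewrite inE; apply/forallP/eqP => [h|<-].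
    apply/setP => i; have := h (((arrange X)^-1)%g i).
    by rewrite permM permKV -Xk -arrange_mem permKV => /eqP <-; rewrite [LHS]inE.
  by move=> t; rewrite permM -(pre_k s) -arrange_mem !inE.
have FE s X : F (arrange X * s)%g X = \sum_i w (s i) * v i.
  rewrite [RHS](reindex_inj (@perm_inj _ (arrange X))) /=.
  by apply: eq_bigr => t _; rewrite permM.
have cGam : (#|Gam| * 'C(n, k) <= n`!)%N.
  have -> : n`! = #|'S_n| by rewrite card_Sn.
  have <- : #|ksets| = 'C(n, k) by rewrite card_draws card_ord.
  rewrite -cardsX -(card_in_imset (_ : {in setX Gam ksets &,
    injective (fun p => (arrange p.2)^-1 * p.1)%g})) ?max_card //.
  move=> [g X] [g' X']; rewrite !in_setX ![_ \in ksets]inE /=.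
  move=> /andP[gG /eqP Xk] /andP[gG' /eqP Xk'] e.
  have eX : pre ((arrange X)^-1 * g)%g = X.
    by apply/eqP; rewrite -pre_Gam // mulKVg.
  have eX' : pre ((arrange X)^-1 * g)%g = X'.
    by apply/eqP; rewrite e -pre_Gam // mulKVg.
  have {eX'}eX : X' = X by rewrite -eX'.
  by move: e; rewrite eX => /mulgI->.
pose lev (g : 'S_n) : {set {set 'I_n}} := [set X in ksets | F g X == x].
have count : (#|[set s : 'S_n | (\sum_i w (s i) * v i == x)%R]|
              <= \sum_(g in Gam) #|lev g|)%N.
  have -> : (\sum_(g in Gam) #|lev g| =
             #|[set p : 'S_n * {set 'I_n} | (p.1 \in Gam) && (p.2 \in lev p.1)]|)%N.
    rewrite -sum1dep_card -(pair_big_dep (mem Gam) (fun g X => X \in lev g)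
      (fun _ _ => 1%N)) /=.
    by apply: eq_bigr => g _; rewrite sum1_card.
  rewrite -(card_in_imset (_ : {in [set s : 'S_n | \sum_i w (s i) * v i == x] &,
    injective (fun s => (arrange (pre s) * s, pre s)%g)})).
    apply/subset_leq_card/subsetP => p /imsetP[s]; rewrite inE => sx ->.
    by rewrite inE /= pre_Gam // eqxx /= !inE pre_k eqxx FE.
  by move=> s s' _ _ [e1 e2]; move: e1; rewrite e2 => /mulgI.
have lev_card g : g \in Gam -> n%:R * #|lev g|%:R
     <= 135 * 'C(n, k)%:R / Num.sqrt k.+1%:R :> R.
  rewrite inE => /forallP gG; apply: dominance_antichain_card => //.
    by move=> X; rewrite !inE => /andP[/eqP].
  move=> X Y; rewrite !inE => /andP[/eqP Xk /eqP FX] /andP[/eqP Yk /eqP FY] dom.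
  apply/eqP; apply: contraT => nXY.
  have := @arranged_sum_lt R n (w \o g) v theta X Y v_inc.
  rewrite Xk Yk => /(_ _ erefl dom nXY); rewrite -/(F g X) -/(F g Y) FX FY ltxx.
  by apply=> t; move/eqP: (gG t) => <-; rewrite inE.
apply: (@le_trans _ _ (\sum_(g in Gam) n%:R * #|lev g|%:R)).
  by rewrite -mulr_sumr ler_wpM2l // -natr_sum ler_nat.
apply: le_trans (ler_sum _ lev_card) _.
rewrite sumr_const -[_ *+ #|_|]mulr_natr mulrAC ler_wpM2r ?invr_ge0 ?sqrtr_ge0 //.
by rewrite -mulrA ler_wpM2l // -natrM ler_nat mulnC.
Qed.

(** The inverse of the permutation which maps an index to its rank. *)
Lemma exists_sorting_perm (R : realDomainType) n (v : 'I_n -> R) :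
  injective v ->
  exists tau : 'S_n, forall i j : 'I_n, (i < j)%N -> v (tau i) < v (tau j).
Proof.
move=> v_inj; pose below i := [set j | v j < v i].
have below_le i j : v i <= v j -> (#|below i| <= #|below j|)%N.
  move=> ij; apply/subset_leq_card/subsetP => l; rewrite !inE => li.
  exact: lt_le_trans li ij.
have below_lt i j : v i < v j -> (#|below i| < #|below j|)%N.
  move=> ij; apply/proper_card/properP; split; last by exists i; rewrite !inE ?ltxx.
  by apply/subsetP => l; rewrite !inE => /lt_trans; apply.
have rank_lt i : (#|below i| < n)%N.
  rewrite -[ltnRHS](card_ord n) -cardsT; apply/proper_card/properP.
  by split; [exact: subsetT | exists i; rewrite ?inE ?ltxx].
have rank_inj : injective (fun i => Ordinal (rank_lt i)).
  move=> i j [e]; apply: v_inj.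
  by case: (ltgtP (v i) (v j)) => // /below_lt; rewrite e ltnn.
pose rho := perm rank_inj.
exists (rho^-1)%g => i j ij; rewrite ltNge; apply/negP => /below_le.
have rk l : #|below ((rho^-1)%g l)| = l :> nat.
  by have := congr1 val (permKV rho l); rewrite permE.
by rewrite !rk leqNgt ij.
Qed.

Lemma perm_level_card (R : rcfType) n (v w : 'I_n -> R) (theta x : R) (k : nat) :
  injective v ->
  k = #|[set i | theta < w i]| -> (0 < k)%N -> (k.*2 <= n)%N ->
  n%:R * #|[set s : 'S_n | \sum_i w (s i) * v i == x]|%:R
    <= 135 * n`!%:R / Num.sqrt k.+1%:R :> R.
Proof.
move=> /exists_sorting_perm[tau v_inc] ek k0 kn.
apply: le_trans (perm_level_card_increasing x v_inc ek k0 kn).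
rewrite ler_wpM2l // ler_nat.
rewrite -(card_imset _ (mulgI tau)); apply/subset_leq_card/subsetP => t.
case/imsetP => s; rewrite !inE => /eqP <- ->.
rewrite [X in _ == X](reindex_inj (@perm_inj _ tau)) /=.
by apply/eqP/eq_bigr => i _; rewrite permM.
Qed.

(** * A median of the weights *)

Lemma exists_median (R : realDomainType) n (w : 'I_n -> R) : (0 < n)%N ->
  exists i, ((#|[set j | (w i < w j)%R]|).*2 <= n)%N /\
            ((#|[set j | (w j < w i)%R]|).*2 <= n)%N.
Proof.
move=> n0; pose above i := #|[set j | w i < w j]|.
have above_lt i j : w i < w j -> (above j < above i)%N.
  move=> ij; apply/proper_card/properP; split; last by exists j; rewrite !inE ?ltxx.
  by apply/subsetP => l; rewrite !inE; apply: lt_trans.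
have [i0 _ i0min] := arg_minnP above (isT : predT (Ordinal n0)).
have i0P : ((above i0).*2 <= n)%N.
  rewrite [above i0](_ : _ = 0%N) //; apply/eqP; rewrite cards_eq0.
  apply/eqP/setP => j; rewrite !inE; apply/negP => /above_lt.
  by rewrite ltnNge i0min.
(* Among the indices with at most [n / 2] values above, the one with the most
   values above is a median: otherwise the next smaller value would qualify. *)
have [i iP imax] := arg_maxnP (P := fun i => (above i).*2 <= n)%N above i0P.
exists i; split=> //; rewrite leqNgt; apply/negP => lo.
have /card_gt0P[j0] : (0 < #|[set j | (w j < w i)%R]|)%N by lia.
rewrite inE => j0i.
have [j ji jmin] := arg_minnP (P := fun j => w j < w i) above j0i.
have : (above j + #|[set j | (w j < w i)%R]| <= n)%N.
  rewrite -[leqRHS](card_ord n) -(cardsC [set l | w l < w i]) addnC leq_add2l.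
  apply/subset_leq_card/subsetP => l; rewrite !inE => jl.
  by apply/negP => li; have := jmin l li; rewrite leqNgt above_lt.
have := above_lt _ _ ji => lt ge.
have /imax : ((above j).*2 <= n)%N by lia.
by rewrite /= leqNgt lt.
Qed.

(** As [k >= eps n / 2] and [eps <= 1], the factor [sqrt k.+1] is at least
    [eps * sqrt n / 2]. *)
Lemma level_prob_le (R : realType) n (eps : R) (v w : 'I_n -> R) (theta x : R) :
  (0 < n)%N -> 0 < eps <= 1 -> injective v ->
  ((#|[set i | (theta < w i)%R]|).*2 <= n)%N ->
  eps * n%:R <= 2 * #|[set i | theta < w i]|%:R ->
  uniform_prob R [set s : 'S_n | \sum_i w (s i) * v i == x]
    <= 270 / (eps * n%:R `^ (3 / 2)).
Proof.
move=> n0 /andP[eps0 eps1] v_inj; set k := #|_| => kn epsk.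
have nR : 0 < n%:R :> R by rewrite ltr0n.
have k0 : (0 < k)%N.
  by rewrite -(ltr0n R); have := mulr_gt0 eps0 nR; lra.
have := perm_level_card x v_inj (erefl k) k0 kn.
rewrite /uniform_prob card_Sn; set N := #|_|%:R; set q := Num.sqrt _ => hN.
have q0 : 0 < q by rewrite sqrtr_gt0 ltr0n.
have q2 : q ^+ 2 = k.+1%:R by rewrite sqr_sqrtr ?ler0n.
have f0 : 0 < n`!%:R :> R by rewrite ltr0n fact_gt0.
have -> : n%:R `^ (3 / 2) = n%:R * Num.sqrt n%:R :> R.
  rewrite (_ : 3 / 2 = 1 + 2^-1); last by lra.
  rewrite powRD ?powRr1 ?powR12_sqrt ?ler0n //.
  by apply/implyP => _; rewrite gt_eqF.
set r := Num.sqrt n%:R.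
have r0 : 0 < r by rewrite sqrtr_gt0.
have r2 : r ^+ 2 = n%:R by rewrite sqr_sqrtr ?ler0n.
have rq : eps * r <= 2 * q.
  rewrite -(@ler_pXn2r _ 2) ?nnegrE ?mulr_ge0 ?(ltW eps0) ?(ltW r0) ?(ltW q0) //.
  rewrite !exprMn q2 r2; apply: (@le_trans _ _ (eps * n%:R)).
    by rewrite ler_wpM2r ?(ltW nR) // expr2 ler_piMl ?(ltW eps0).
  by apply: le_trans epsk _; rewrite -natr1; have := ler0n R k; lra.
rewrite ler_pdivrMr // mulrAC ler_pdivlMr; last by rewrite !mulr_gt0.
apply: (@le_trans _ _ (135 * n`!%:R / q * (2 * q))); last first.
  by rewrite le_eqVlt; apply/orP; left; apply/eqP; field; rewrite gt_eqF.
have -> : N * (eps * (n%:R * r)) = n%:R * N * (eps * r) by ring.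
by rewrite ler_pM ?mulr_ge0 ?(ltW nR) ?(ltW eps0) ?(ltW r0) ?ler0n.
Qed.

Theorem corollary1p5 (R : realType) :
  exists C : R, 0 < C /\
    forall (n : nat) (eps : R) (v w : 'rV[R]_n),
      (1 <= n)%N -> 0 < eps ->
      injective (v 0) ->
      (forall y : R, (multiplicity w y)%:R <= (1 - eps) * n%:R) ->
      forall x : R,
        uniform_prob R [set s : 'S_n | dotv (col_perm s w) v == x]
          <= C / (eps * n%:R `^ (3 / 2)).
Proof.
exists 270; split=> // n eps v w n0 eps0 v_inj mult x.
have [i [hi lo]] := exists_median (w 0) n0.
have nR : 0 < n%:R :> R by rewrite ltr0n.
have eps1 : 0 < eps <= 1.
  rewrite eps0 /=; have := le_trans (ler0n R _) (mult 0).
  by rewrite pmulr_lge0 // subr_ge0.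
set up := #|_| in hi; set dw := #|_| in lo.
have total : (up + dw + multiplicity w (w 0%R i) = n)%N.
  rewrite -[RHS](card_ord n) -(cardsC [set j | w 0 i < w 0 j]) -addnA.
  congr (_ + _)%N; rewrite -[RHS](cardsID [set j | w 0 j < w 0 i]).
  congr (_ + _)%N; apply: eq_card => j; rewrite !inE.
    by rewrite -leNgt; case: ltgtP.
  by case: ltgtP.
have many : eps * n%:R <= up%:R + dw%:R.
  have := congr1 (fun k => k%:R : R) total; rewrite /= !natrD.
  by have := mult (w 0 i); lra.
have E s : dotv (col_perm s w) v = \sum_j w 0 (s j) * v 0 j.
  by apply: eq_bigr => j _; rewrite mxE.
(* If there are too few coordinates above the median, negating [w] exchanges
   the two sides. *)
have [big|small] := leP (eps * n%:R) (2 * up%:R).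
  have := @level_prob_le R n eps (v 0) (w 0) (w 0 i) x n0 eps1 v_inj hi big.
  by congr (uniform_prob R _ <= _); apply/setP => s; rewrite !inE E.
have edw : #|[set j | - w 0 i < - w 0 j]| = dw.
  by apply: eq_card => j; rewrite !inE ltrN2.
have := @level_prob_le R n eps (v 0) (fun j => - w 0 j) (- w 0 i) (- x) n0 eps1 v_inj.
rewrite edw => /(_ lo) h.
have {}h := h ltac:(lra).
apply: le_trans h; rewrite le_eqVlt; apply/orP; left; apply/eqP.
congr (uniform_prob R _); apply/setP => s; rewrite !inE E.
under [in RHS]eq_bigr do rewrite mulNr.
by rewrite sumrN eqr_opp.
Qed.
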